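(* Let $G$ be a finite group that satisfies neither of the identities $xytxy\approx yxtyx$ and $xytyx\approx yxtxy$. Then the monoid $S(xtx)\times G$ generates a monoid variety with continuum many subvarieties.
   Context: Monoids are considered as algebras with an associative binary operation and a nullary operation fixing the identity element; varieties and subvarieties are varieties of monoids in this signature, and $G$ is regarded as a monoid. Let $F$ be the free semigroup over a countably infinite alphabet and $F^1$ the monoid obtained from $F$ by adjoining the empty word as an identity element. For a word $\mathbf w\in F^1$, let $\overline{W}$ be the set of all subwords (contiguous factors, including the empty word and $\mathbf w$ itself) of $\mathbf w$; then $F^1\setminus\overline W$ is an ideal of $F^1$, and $S(\mathbf w)$ denotes the Rees quotient monoid $F^1/(F^1\setminus\overline W)$. Here $S(xtx)$ is this monoid for the word $xtx$, where $x$ and $t$ are distinct letters. ''Continuum many'' means of cardinality $2^{\aleph_0}$. *)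

(* Defs.v *)
From HB Require Import structures.
From mathcomp Require Import all_boot.
From mathcomp Require Import boolp.

Set Implicit Arguments.
Unset Strict Implicit.
Unset Printing Implicit Defensive.

Local Open Scope quotient_scope.

(* The elements of the free monoid F^1 over the countably infinite alphabet
   nat, with concatenation as product. *)
Definition word := seq nat.

Definition letter_x : nat := 0.
Definition letter_y : nat := 1.
Definition letter_t : nat := 2.

(* The Rees quotient F^1 / (F^1 \ W), W the set of factors of w, is F^1 modulo
   the congruence that collapses the ideal of non-factors of w to one point. *)
Section ReesQuotient.
Variable w : word.

Definition rees_rel : rel word :=
  fun u v => (u == v) || (~~ infix u w && ~~ infix v w).

Lemma rees_rel_equiv : equiv_class_of rees_rel.
Proof.
split=> [u|u v|v u s]; rewrite /rees_rel ?eqxx //; first by rewrite eq_sym andbC.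
case: eqP => [->//|_] /= /andP[nu nv].
by case: eqP => [<-|_] /=; rewrite nu nv /= ?orbT // => ->; rewrite orbT.
Qed.

Canonical rees_equiv := EquivRelPack rees_rel_equiv.
Canonical rees_encModRel := defaultEncModRel rees_rel.

Definition Smon := {eq_quot rees_rel}.
HB.instance Definition _ := Choice.on Smon.
HB.instance Definition _ := EqQuotient.on Smon.

Lemma rees_rel_cat (u u' v v' : word) :
  rees_rel u u' -> rees_rel v v' -> rees_rel (u ++ v) (u' ++ v').
Proof.
rewrite /rees_rel => /orP[/eqP<-|/andP[nu nu']] /orP[/eqP<-|/andP[nv nv']].
- by rewrite eqxx.
- by rewrite (contra (@catl_infix _ _ _ _) nv) (contra (@catl_infix _ _ _ _) nv') orbT.
- by rewrite (contra (@catr_infix _ _ _ _) nu) (contra (@catr_infix _ _ _ _) nu') orbT.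
- by rewrite (contra (@catr_infix _ _ _ _) nu) (contra (@catr_infix _ _ _ _) nu') orbT.
Qed.

Definition rees_one : Smon := \pi_Smon [::].
Definition rees_mul : Smon -> Smon -> Smon := fun a b => \pi_Smon (repr a ++ repr b).

Lemma rees_mul_pi (u v : word) : rees_mul (\pi u) (\pi v) = \pi_Smon (u ++ v).
Proof.
by apply/eqquotP; apply: rees_rel_cat; apply/(eqquotP Smon); exact: reprK.
Qed.

Lemma rees_mulA : associative rees_mul.
Proof.
move=> a b c; rewrite -[a]reprK -[b]reprK -[c]reprK.
by rewrite !rees_mul_pi catA.
Qed.

Lemma rees_mul1 : left_id rees_one rees_mul.
Proof. by move=> a; rewrite -[a]reprK rees_mul_pi. Qed.

Lemma rees_mulr1 : right_id rees_one rees_mul.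
Proof. by move=> a; rewrite -[a]reprK rees_mul_pi cats0. Qed.

HB.instance Definition _ := isMonoid.Build Smon rees_mulA rees_mul1 rees_mulr1.

End ReesQuotient.

Section DirectProduct.
Variables (I : Type) (M : I -> monoidType).

Definition direct_prod := forall i, M i.
HB.instance Definition _ := Choice.on direct_prod.

Definition direct_prod_one : direct_prod := fun i => 1%g.
Definition direct_prod_mul (f g : direct_prod) : direct_prod :=
  fun i => (f i * g i)%g.

Lemma direct_prod_mulA : associative direct_prod_mul.
Proof. by move=> f g h; apply: functional_extensionality_dep => i; apply: mulgA. Qed.

Lemma direct_prod_mul1 : left_id direct_prod_one direct_prod_mul.
Proof. by move=> f; apply: functional_extensionality_dep => i; apply: mul1g. Qed.

Lemma direct_prod_mulr1 : right_id direct_prod_one direct_prod_mul.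
Proof. by move=> f; apply: functional_extensionality_dep => i; apply: mulg1. Qed.

HB.instance Definition _ := isMonoid.Build direct_prod
  direct_prod_mulA direct_prod_mul1 direct_prod_mulr1.

End DirectProduct.

Definition satisfies (M : monoidType) (u v : word) : Prop :=
  forall phi : nat -> M, (\prod_(i <- u) phi i = \prod_(i <- v) phi i)%g.

Definition monoid_class := monoidType -> Prop.

(* Closure under injective morphisms is closure under submonoids and isomorphic
   copies; the empty product puts the trivial monoid in every variety. *)
Record variety (V : monoid_class) : Prop := Variety {
  variety_quotient : forall (M N : monoidType) (f : M -> N),
    monoid_morphism f -> (forall y, exists x, f x = y) -> V M -> V N;
  variety_sub : forall (M N : monoidType) (f : N -> M),
    monoid_morphism f -> injective f -> V M -> V N;
  variety_prod : forall (I : Type) (M : I -> monoidType),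
    (forall i, V (M i)) -> V (direct_prod M)
}.

(* Taking M itself as the index type also forces the universe of index types
   in variety_prod to be as large as that of carriers of monoids. *)
Lemma variety_power (V : monoid_class) (M : monoidType) :
  variety V -> V M -> V (direct_prod (fun _ : M => M)).
Proof. by move=> varV VM; apply: variety_prod. Qed.

Definition generated_variety (M : monoidType) : monoid_class :=
  fun N => forall V : monoid_class, variety V -> V M -> V N.

Lemma generated_variety_is_variety (M : monoidType) :
  variety (generated_variety M).
Proof.
split=> [A B f fM fS VA V vV VM|A B f fM fI VA V vV VM|I F VF V vV VM].
- exact: (variety_quotient vV fM fS (VA V vV VM)).
- exact: (variety_sub vV fM fI (VA V vV VM)).
- by apply: (variety_prod vV) => i; apply: VF.
Qed.

Definition subvariety (V W : monoid_class) : Prop :=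
  variety W /\ (forall M, W M -> V M).

(* P is in bijection with 2^nat.  The type monoid_class is too large for the
   universe of classical_sets, so the relation #= of cardinality does not apply
   to it. *)
Definition continuum_many (T : Type) (P : T -> Prop) : Prop :=
  exists f : (nat -> bool) -> T,
    injective f /\ (forall x, P x <-> exists a, f a = x).

(* Main.v *)
(* Write V for the variety generated by S(xtx) x G.  If B and C list the same
   letters without repetition and t is another letter, then B t C is an isoterm
   for V: S(xtx) fixes which letters occur before and after t, and the
   hypotheses on G say that G tells apart the four words obtained from xytxy by
   permuting the letters within each half.  Hence S(B t C) lies in V.

   Take for B and C the orderings w1(n) and w2(n) of the letters of a simple
   permutation: a set of at least two letters that is contiguous in both is the
   set of all letters.  So a substitution that sends w1(n) t w2(n) to a
   factor of w1(k) t w2(k) either sends w1(n) and w2(n) to the same word, or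
   maps them onto w1(k) and w2(k) and embeds the k-th permutation in the n-th.
   The permutations form an antichain, so for k <> n the monoid
   S(w1(k) t w2(k)) satisfies w1(n) t w2(n) = w1(n) t w1(n).  The identities
   w1(n) t w2(n) = w1(n) t w1(n) are therefore independent within V, and each
   set of them defines a different subvariety.  Conversely, by Birkhoff's
   theorem a variety is determined by a subset of the countable set of pairs of
   words, and Cantor-Bernstein turns the two injections into a bijection. *)

From HB Require Import structures.
Require Import Defs.
From mathcomp Require Import all_boot all_fingroup.
From mathcomp Require Import boolp classical_sets functions cardinality.
From mathcomp Require Import zify.

Set Implicit Arguments.
Unset Strict Implicit.
Unset Printing Implicit Defensive.

Local Open Scope quotient_scope.

(** * Birkhoff's theorem *)

Section GeneratedSubmonoid.
Variables (X : Type) (M : monoidType) (phi : X -> M).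

Definition generated_by : pred M :=
  fun m => `[< exists s : seq X, m = (\prod_(x <- s) phi x)%g >].

Definition gen_submonoid := {m : M | generated_by m}.
HB.instance Definition _ := Choice.on gen_submonoid.

Lemma generated_by_one : generated_by 1%g.
Proof. by apply/asboolP; exists [::]; rewrite big_nil. Qed.

Lemma generated_by_mul (a b : M) :
  generated_by a -> generated_by b -> generated_by (a * b)%g.
Proof.
move=> /asboolP[s ->] /asboolP[r ->].
by apply/asboolP; exists (s ++ r); rewrite big_cat.
Qed.

Definition gen_one : gen_submonoid := exist generated_by _ generated_by_one.
Definition gen_mul (a b : gen_submonoid) : gen_submonoid :=
  exist generated_by _ (generated_by_mul (valP a) (valP b)).

Lemma gen_mulA : associative gen_mul.
Proof. by move=> a b c; apply: val_inj; apply: mulgA. Qed.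

Lemma gen_mul1 : left_id gen_one gen_mul.
Proof. by move=> a; apply: val_inj; apply: mul1g. Qed.

Lemma gen_mulr1 : right_id gen_one gen_mul.
Proof. by move=> a; apply: val_inj; apply: mulg1. Qed.

HB.instance Definition _ := isMonoid.Build gen_submonoid gen_mulA gen_mul1 gen_mulr1.

Lemma gen_submonoidP (a : gen_submonoid) :
  exists s : seq X, val a = (\prod_(x <- s) phi x)%g.
Proof. exact: asboolW (valP a). Qed.

End GeneratedSubmonoid.

Section Birkhoff.
Variables (W : monoid_class) (varW : variety W) (N : monoidType).

Definition identities (K : monoid_class) (u v : word) : Prop :=
  forall M, K M -> satisfies M u v.

Hypothesis idN : forall u v, identities W u v -> satisfies N u v.

(** Only finitely many elements of [N] occur in [u] and [v]; numbering them by their place in [L]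
    turns both into words over nat, to which [idN] applies. *)
Lemma identity_over_carrier (u v : seq N) :
  (forall (M : monoidType) (phi : N -> M), W M ->
     (\prod_(x <- u) phi x = \prod_(x <- v) phi x)%g) ->
  (\prod_(x <- u) x = \prod_(x <- v) x)%g.
Proof.
move=> uv; pose L := undup (u ++ v); pose c x := index x L.
have lift (w : seq N) : {subset w <= u ++ v} ->
  (\prod_(x <- w) x = \prod_(i <- map c w) nth 1 L i)%g.
  move=> sw; rewrite big_map; apply: eq_big_seq => x /sw xw.
  by rewrite nth_index // mem_undup.
rewrite !lift; try by move=> x xw; rewrite mem_cat xw ?orbT.
by apply: idN => M WM psi; rewrite !big_map; apply: uv.
Qed.

(** [N] is a quotient of a relatively free monoid. Each pair of words over [N] that fails somewhere
    in [W] gets a member of [W] and a valuation refuting it; in the product of these members, the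
    generators [phi x] satisfy only relations valid throughout [W]. *)
Lemma birkhoff : W N.
Proof.
pose agree (M : monoidType) (phi : N -> M) (p : seq N * seq N) :=
  (\prod_(x <- p.1) phi x = \prod_(x <- p.2) phi x)%g.
have witness (p : seq N * seq N) : exists D : {M : monoidType & N -> M},
    W (projT1 D) /\ (agree _ (projT2 D) p ->
      forall (M : monoidType) (phi : N -> M), W M -> agree M phi p).
  have [h|/existsNP[M /existsNP[phi /not_implyP[WM ne]]]] :=
    pselect (forall (M : monoidType) (phi : N -> M), W M -> agree M phi p).
    (* A pair valid throughout [W] needs no refutation; the empty product fills its place in the
       family. *)
    pose T : monoidType := direct_prod (fun _ : void => N).
    exists (existT (fun M : monoidType => N -> M) T (fun=> 1%g)).
    by split=> //=; apply: (variety_prod varW) => -[].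
  by exists (existT (fun M : monoidType => N -> M) M phi); split.
have [D DP] := choice witness.
pose P := direct_prod (fun p => projT1 (D p)).
pose phi (x : N) : P := fun p => projT2 (D p) x.
have phiE s p : (\prod_(x <- s) phi x)%g p = (\prod_(x <- s) projT2 (D p) x)%g.
  by elim: s => [|x s IH]; rewrite ?big_nil ?big_cons // -IH.
have WP : W P by apply: (variety_prod varW) => p; case: (DP p).
have WS : W (gen_submonoid phi).
  by apply: (@variety_sub _ varW P (gen_submonoid phi) (fun a => val a)) => //; apply: val_inj.
have phi_id (s r : seq N) : (\prod_(x <- s) phi x = \prod_(x <- r) phi x)%g ->
    (\prod_(x <- s) x = \prod_(x <- r) x)%g.
  move=> sr; apply: identity_over_carrier => M psi WM.
  have [_] := DP (s, r); apply => //.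
  by rewrite /agree -!phiE sr.
have [rep repP] := choice (@gen_submonoidP _ _ phi).
(* By [phi_id] the value of [f] does not depend on the word chosen by [rep], which makes [f] a
   morphism. *)
pose f a := (\prod_(x <- rep a) x)%g.
have fE (a : gen_submonoid phi) s :
    val a = (\prod_(x <- s) phi x)%g -> f a = (\prod_(x <- s) x)%g.
  by move=> sa; apply: phi_id; rewrite -repP.
apply: (variety_quotient varW (f := f)) WS.
  split; first by rewrite (fE _ [::]) ?big_nil.
  move=> a b; rewrite (fE _ (rep a ++ rep b)) ?big_cat //.
  by rewrite /= -!repP.
move=> y; have gy : generated_by phi (phi y).
  by apply/asboolP; exists [:: y]; rewrite big_seq1.
by exists (exist (generated_by phi) _ gy); rewrite (fE _ [:: y]) ?big_seq1.
Qed.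

End Birkhoff.

(** * Identities and generated varieties *)

Lemma satisfies_quotient (M N : monoidType) (f : M -> N) u v :
  monoid_morphism f -> (forall y, exists x, f x = y) ->
  satisfies M u v -> satisfies N u v.
Proof.
move=> [f1 fM] fS uv phi; have [g gK] := choice fS.
have fprod w : (\prod_(i <- w) phi i = f (\prod_(i <- w) g (phi i)))%g.
  by rewrite (big_morph f fM f1); apply: eq_bigr => i _; rewrite gK.
by rewrite !fprod uv.
Qed.

Lemma satisfies_sub (M N : monoidType) (f : N -> M) u v :
  monoid_morphism f -> injective f -> satisfies M u v -> satisfies N u v.
Proof.
by move=> [f1 fM] fI uv phi; apply: fI; rewrite !(big_morph f fM f1) uv.
Qed.

Lemma satisfies_direct_prod I (M : I -> monoidType) u v :
  (forall i, satisfies (M i) u v) -> satisfies (direct_prod M) u v.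
Proof.
move=> uv phi; apply: functional_extensionality_dep => i.
have prodE w : (\prod_(j <- w) phi j)%g i = (\prod_(j <- w) phi j i)%g.
  by elim: w => [|j w IH]; rewrite ?big_nil ?big_cons // -IH.
by rewrite !prodE uv.
Qed.

Lemma variety_identities (V : monoid_class) T (P : T -> Prop) (l r : T -> word) :
  variety V -> variety (fun M => V M /\ forall t, P t -> satisfies M (l t) (r t)).
Proof.
move=> varV; split=> [M N f fM fS|M N f fM fI|I M] VM.
- split; first by apply: variety_quotient fM fS VM.1.
  by move=> t /VM.2; apply: satisfies_quotient fM fS.
- split; first by apply: variety_sub fM fI VM.1.
  by move=> t /VM.2; apply: satisfies_sub fM fI.
- split; first by apply: variety_prod => // i; case: (VM i).
  by move=> t Pt; apply: satisfies_direct_prod => i; apply: (VM i).2.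
Qed.

Lemma generated_varietyE (M N : monoidType) :
  generated_variety M N <-> forall u v, satisfies M u v -> satisfies N u v.
Proof.
split=> [MN u v uv|MN V varV VM].
  (* The models of the single identity [u], [v] form a variety: the class of all monoids cut down by
     a one-element family. *)
  suff: True /\ (forall t : unit, True -> satisfies N u v) by case=> _ /(_ tt I).
  have varT : variety (fun=> True) by [].
  exact: MN (variety_identities (fun=> True) (fun=> u) (fun=> v) varT) _.
by apply: birkhoff => // u v /(_ M VM); apply: MN.
Qed.

(** * Counting subvarieties *)

Definition theory (W : monoid_class) : nat -> bool := fun n =>
  if unpickle n is Some p then `[< identities W p.1 p.2 >] else false.

Definition models (c : nat -> bool) : monoid_class := fun M =>
  forall u v : word, c (pickle (u, v)) -> satisfies M u v.

Lemma models_theory (W : monoid_class) : variety W -> models (theory W) = W.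
Proof.
move=> varW; apply: funext => M; apply: propext; split.
  move=> idM; apply: birkhoff => // u v uv; apply: idM.
  by rewrite /theory pickleK; apply/asboolP.
by move=> WM u v; rewrite /theory pickleK => /asboolP; apply.
Qed.

(** [S k] violates only the identity of index [k], so a set of indices can be read off from the
    [S k] that lie in the subvariety it defines. *)
Lemma continuum_many_subvarieties (V : monoid_class) (l r : nat -> word)
    (S : nat -> monoidType) :
  variety V -> (forall n, V (S n)) ->
  (forall k n, satisfies (S k) (l n) (r n) <-> k != n) ->
  continuum_many (subvariety V).
Proof.
move=> varV VS indep.
pose W (A : nat -> bool) : monoid_class :=
  fun M => V M /\ forall n, A n -> satisfies M (l n) (r n).
have subW A : subvariety V (W A).
  by split=> [|M []//]; apply: variety_identities.
have WS A k : W A (S k) <-> ~~ A k.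
  split=> [[_ satA]|Ak]; first by apply/negP => /satA /indep; rewrite eqxx.
  by split=> // n An; apply/indep; apply: contra Ak => /eqP->.
(* Subvarieties are replaced by their theories, which live in the small type [nat -> bool], where
   cardinals can be compared; [models] leads back. *)
pose Q : set (nat -> bool) := [set c | exists2 W', subvariety V W' & c = theory W']%classic.
have modelsQ c : Q c -> subvariety V (models c) /\ theory (models c) = c.
  by move=> [W' subW' ->]; rewrite models_theory //; case: subW'.
have injW : injective (fun A => theory (W A)).
  move=> A B /= AB; have {}AB : W A = W B.
    by rewrite -(models_theory (subW A).1) AB (models_theory (subW B).1).
  apply: funext => k; apply: negb_inj; apply/idP/idP => /WS.
    by rewrite AB => /WS.
  by rewrite -AB => /WS.
have /card_set_bijP[h [hQ hinj hsurj]] : ([set: nat -> bool] #= Q)%card.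
  apply: Cantor_Bernstein; last exact: subset_card_le.
  have /card_eqPle[_ le1] :=
    inj_card_eq (in2W injW : {in [set: nat -> bool]%classic &, injective _}).
  apply: (card_le_trans le1); apply: subset_card_le => _ [A _ <-].
  by exists (W A).
exists (fun a => models (h a)); split.
  move=> a b ab; apply: hinj; rewrite ?in_setT //.
  by rewrite -(modelsQ _ (hQ a I)).2 ab (modelsQ _ (hQ b I)).2.
move=> W'; split=> [subW'|[a <-]]; last by case: (modelsQ _ (hQ a I)).
have [|a _ ha] := hsurj (theory W'); first by exists W'.
by exists a; rewrite ha models_theory //; case: subW'.
Qed.

(** * Isoterms *)

Definition subst (phi : nat -> word) (u : word) : word :=
  flatten [seq phi i | i <- u].

Lemma subst_cat phi u v : subst phi (u ++ v) = subst phi u ++ subst phi v.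
Proof. by rewrite /subst map_cat flatten_cat. Qed.

Lemma satisfies_Smon (w u v : word) :
  satisfies (Smon w) u v <->
  forall phi, rees_rel w (subst phi u) (subst phi v).
Proof.
have prod_pi phi s : (\prod_(i <- s) \pi_(Smon w) (phi i))%g = \pi_(Smon w) (subst phi s).
  elim: s => [|i s IH]; first by rewrite big_nil.
  by rewrite big_cons IH; apply: rees_mul_pi.
split=> [uv phi|uv phi].
  by apply/(eqquotP (Smon w)); rewrite -!prod_pi uv.
have phiE s : (\prod_(i <- s) phi i)%g =
    \pi_(Smon w) (subst (fun i => generic_quotient.repr (phi i)) s).
  by rewrite -prod_pi; apply: eq_bigr => i _; rewrite reprK.
by rewrite !phiE; apply/(eqquotP (Smon w)); apply: uv.
Qed.

Lemma satisfies_context (M : monoidType) phi u v p q :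
  satisfies M u v -> satisfies M (p ++ subst phi u ++ q) (p ++ subst phi v ++ q).
Proof.
move=> uv psi; rewrite !big_cat /=; congr (_ * (_ * _))%g.
by rewrite !big_flatten !big_map; apply: uv.
Qed.

Definition isoterm (M : monoidType) (w : word) :=
  forall w', satisfies M w w' -> w' = w.

(** If [M] satisfies an identity and a substitution sends one side to a factor of [w], replacing
    that factor by the image of the other side gives an identity of [M] for [w]. Since [w] is an
    isoterm, the two images coincide. *)
Lemma isoterm_Smon (M : monoidType) w :
  isoterm M w -> generated_variety M (Smon w).
Proof.
move=> isow; apply/generated_varietyE => u v uv; apply/satisfies_Smon => phi.
have closed a b : satisfies M a b -> infix (subst phi a) w -> subst phi b = subst phi a.
  move=> ab /infixP[p [q wE]].
  have := @isow (p ++ subst phi b ++ q).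
  rewrite wE => /(_ (satisfies_context phi p q ab)) E.
  have sz : size (subst phi b) = size (subst phi a).
    by have := congr1 size E; rewrite !size_cat; lia.
  by move/eqP: E; rewrite !eqseq_cat // !eqxx andbT => /eqP.
have vu : satisfies M v u by move=> psi; rewrite uv.
rewrite /rees_rel.
have [fu|nfu] := boolP (infix (subst phi u) w); first by rewrite (closed u v) ?eqxx.
have [fv|nfv] := boolP (infix (subst phi v) w); last by rewrite orbT.
by rewrite (closed v u) ?eqxx.
Qed.

(** * Isoterms of the form B t C *)

Lemma satisfies_pair (M N : monoidType) u v :
  satisfies (M * N)%type u v -> satisfies M u v /\ satisfies N u v.
Proof.
move=> uv; split.
  by apply: (@satisfies_quotient (M * N)%type M fst) uv => // x; exists (x, 1%g).
by apply: (@satisfies_quotient (M * N)%type N snd) uv => // x; exists (1%g, x).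
Qed.

(** Restricting to the two first letters shows that they agree; deleting a common head keeps all
    restrictions equal. *)
Lemma eq_from_pairs (s s' : word) :
  (forall x y, filter (pred2 x y) s = filter (pred2 x y) s') -> s = s'.
Proof.
elim: s s' => [|a s IH] [|b s'] // E.
- by have := E b b; rewrite /= eqxx.
- by have := E a a; rewrite /= eqxx.
have ab : a = b by have := E a b; rewrite /= !eqxx orbT => -[].
congr (_ :: _) => //; apply: IH => x y; have := E x y.
by rewrite /= -ab; case: ifP => // _ [].
Qed.

Lemma filter_pair_uniq (s : word) x y :
  uniq s -> x \in s -> y \in s -> x != y ->
  exists b : bool, filter (pred2 x y) s = if b then [:: x; y] else [:: y; x].
Proof.
move=> us xs ys xy.
have : perm_eq (filter (pred2 x y) s) [:: x; y].
  apply: uniq_perm; rewrite ?filter_uniq //= ?inE ?xy // => z.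
  rewrite mem_filter !inE /=; case: eqP => [->|_]; first by rewrite xs.
  by case: eqP => [->|].
case: [seq z <- s | _] => [|a [|b [|c r]]] pe; have := perm_size pe => //= _.
have := perm_mem pe a; have := perm_mem pe b; have := perm_uniq pe.
rewrite /= !inE xy !eqxx !orbT /= andbT.
move=> ab /esym/orP[/eqP bx|/eqP yb] /esym/orP[/eqP ax|/eqP ay]; subst a b.
- by rewrite eqxx in ab.
- by exists false.
- by exists true.
- by rewrite eqxx in ab.
Qed.

(** For equal or missing letters the restriction has length at most one, so being a permutation
    already settles it. *)
Lemma eq_uniq_from_pairs (s s' : word) :
  uniq s -> perm_eq s' s ->
  (forall x y, x \in s -> y \in s -> x != y ->
    filter (pred2 x y) s = filter (pred2 x y) s') -> s = s'.
Proof.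
move=> us pe E; apply: eq_from_pairs => x y.
have pef : perm_eq (filter (pred2 x y) s) (filter (pred2 x y) s').
  by rewrite perm_filter // perm_sym.
have [/and3P[xs ys xy]|deg] := boolP [&& x \in s, y \in s & x != y]; first exact: E.
apply: perm_small_eq (pef); rewrite -(perm_size pef).
have le1 z : {subset filter (pred2 x y) s <= [:: z]} -> size (filter (pred2 x y) s) <= 1.
  by apply: (@uniq_leq_size _ _ [:: z]); rewrite filter_uniq.
rewrite !negb_and negbK in deg; have [xs|xs] := boolP (x \in s).
  apply: (le1 x) => z; rewrite mem_filter !inE => /andP[/orP[//|/eqP-> ys]].
  by move: deg; rewrite xs ys /= eq_sym.
apply: (le1 y) => z; rewrite mem_filter !inE => /andP[/orP[/eqP->|//]].
by rewrite (negbTE xs).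
Qed.

Section GroupSeparation.
Variable G : finGroupType.
Hypothesis hG1 : ~ forall a b c : G, (a * b * c * (a * b) = b * a * c * (b * a))%g.
Hypothesis hG2 : ~ forall a b c : G, (a * b * c * (b * a) = b * a * c * (a * b))%g.

Let pairmul (d : bool) (a b : G) : G := if d then (a * b)%g else (b * a)%g.

(** If exactly one half differs, cancelling the other with c = 1 makes [G] commutative, against
    [hG1]. If both differ, the hypothesis is one of the two excluded identities, up to exchanging
    its sides. *)
Lemma group_separates d e d' e' :
  (forall a b c, pairmul d a b * c * pairmul e a b =
                 pairmul d' a b * c * pairmul e' a b)%g -> d = d' /\ e = e'.
Proof.
have nc : ~ forall a b : G, (a * b = b * a)%g.
  by move=> C; apply: hG1 => a b c; rewrite (C b a).
move=> E; have first_half : e = e' -> d = d'.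
  move=> ee'; subst e'; case: d d' E => [] [] // E; case: nc => a b;
  by have := E a b 1%g; rewrite /= !mulg1 => /mulIg.
have second_half : d = d' -> e = e'.
  move=> dd'; subst d'; case: e e' E {first_half} => [] [] // E; case: nc => a b;
  by have := E a b 1%g; rewrite /= => /mulgI.
case: (eqVneq d d') => [dd'|nd]; first by split; last exact: second_half.
have ne : e != e' by apply: contraNneq nd => /first_half->.
case: d d' e e' nd ne E {first_half second_half} => [] [] // [] [] // _ _ E; try by [].
- by case: hG2 => a b c; rewrite -[LHS]E.
- by case: hG1 => a b c; rewrite -[LHS]E.
Qed.

End GroupSeparation.

Section Isoterm.
Variable G : finGroupType.
Hypothesis hG1 : ~ satisfies G
     [:: letter_x; letter_y; letter_t; letter_x; letter_y]
     [:: letter_y; letter_x; letter_t; letter_y; letter_x].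
Hypothesis hG2 : ~ satisfies G
     [:: letter_x; letter_y; letter_t; letter_y; letter_x]
     [:: letter_y; letter_x; letter_t; letter_x; letter_y].

Variables (t : nat) (B C : word).
Hypotheses (uB : uniq B) (BC : perm_eq C B) (tB : t \notin B).

Let tC : t \notin C. Proof. by rewrite (perm_mem BC). Qed.
Let uC : uniq C. Proof. by rewrite (perm_uniq BC). Qed.

(** Erase all letters but [x] and [t]: the image of B t C is xtx or t, a factor of xtx, so the other
    side must have the same image. *)
Lemma xtx_restrict w' x : x != t ->
  satisfies (Smon [:: letter_x; letter_t; letter_x]) (B ++ t :: C) w' ->
  filter (pred2 x t) w' = filter (pred2 x t) (B ++ t :: C).
Proof.
move=> xt /satisfies_Smon.
pose r i := if i == x then letter_x else letter_t.
have rx : r x = letter_x by rewrite /r eqxx.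
have rt : r t = letter_t by rewrite /r eq_sym (negbTE xt).
move=> /(_ (fun i => if pred2 x t i then [:: r i] else [::])).
have substE u : subst (fun i => if pred2 x t i then [:: r i] else [::]) u
    = map r (filter (pred2 x t) u).
  by elim: u => //= i u IH; rewrite /subst /= -/(subst _ _) IH; case: ifP.
rewrite !substE => rel.
have filt s : uniq s -> t \notin s ->
    filter (pred2 x t) s = if x \in s then [:: x] else [::].
  move=> us ts; have -> : filter (pred2 x t) s = filter (pred1 x) s.
    by apply: eq_in_filter => i si /=; case: (eqVneq i t) si ts => [->->|_]; rewrite ?orbF.
  case: ifP => xs; first exact: filter_pred1_uniq.
  by apply/eqP; rewrite -[_ == _]negbK -has_filter has_pred1 xs.
have inf : infix (map r (filter (pred2 x t) (B ++ t :: C))) [:: letter_x; letter_t; letter_x].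
  rewrite filter_cat /= eqxx orbT !filt // (perm_mem BC).
  by case: ifP => _; rewrite /= ?rx rt.
move: rel; rewrite /rees_rel inf /= orbF => /eqP/esym.
apply: (inj_in_map (A := pred2 x t)); rewrite ?inE.
- by move=> i j /orP[]/eqP-> /orP[]/eqP->; rewrite ?rx ?rt.
- by apply/allP => i; rewrite mem_filter => /andP[].
- by apply/allP => i; rewrite mem_filter => /andP[].
Qed.

Lemma split_isoterm :
  isoterm (Smon [:: letter_x; letter_t; letter_x] * G)%type (B ++ t :: C).
Proof.
move=> w' /satisfies_pair[satS satG].
have restr x : x != t -> filter (pred2 x t) w' = filter (pred2 x t) (B ++ t :: C).
  by move=> xt; apply: xtx_restrict.
have tF : filter (pred1 t) w' = [:: t].
  (* Any letter other than [t] would do; the restriction shows that [t] occurs exactly once in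
     [w']. *)
  have /restr : t.+1 != t by rewrite neq_ltn ltnSn orbT.
  move/(congr1 (filter (pred1 t))); rewrite -!filter_predI.
  have E : predI (pred1 t) (pred2 t.+1 t) =1 pred1 t.
    by move=> i /=; case: (i == t); rewrite ?orbT.
  have nt s : t \notin s -> filter (pred1 t) s = [::].
    by move=> ts; apply/eqP; rewrite -[_ == _]negbK -has_filter has_pred1.
  by rewrite !(eq_filter E) filter_cat /= eqxx (nt B) // (nt C).
have tw : t \in w'.
  by have := mem_head t [::]; rewrite -tF mem_filter => /andP[].
case/splitPr: tw restr satG tF => p q restr satG tF.
have [tp tq] : t \notin p /\ t \notin q.
  have := congr1 size tF; rewrite filter_cat size_cat /= eqxx /= !size_filter.
  rewrite addnS => -[/eqP]; rewrite addn_eq0.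
  by case/andP=> [/eqP/count_memPn ? /eqP/count_memPn ?].
have {}restr x : x != t ->
    filter (pred2 x t) p = filter (pred2 x t) B /\ filter (pred2 x t) q = filter (pred2 x t) C.
  move=> /restr /eqP; rewrite !filter_cat /= eqxx orbT.
  have nf s : t \notin s -> t \notin filter (pred2 x t) s.
    by apply: contra; rewrite mem_filter => /andP[].
  by rewrite eqseq_pivotl ?nf // => /andP[/eqP-> /eqP->].
have cnt s s' : t \notin s -> t \notin s' ->
    (forall x, x != t -> filter (pred2 x t) s = filter (pred2 x t) s') -> perm_eq s s'.
  move=> ts ts' E; apply/allP => x _ /=; apply/eqP.
  have [->|/E/(congr1 (count_mem x))] := eqVneq x t.
    by rewrite !(count_memPn _).
  have F : predI (pred1 x) (pred2 x t) =1 pred1 x.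
    by move=> i /=; case: (i == x).
  by rewrite !count_filter !(eq_count F).
have pB : perm_eq p B by apply: cnt => // x /restr[].
have qC : perm_eq q C by apply: cnt => // x /restr[].
have up : uniq p by rewrite (perm_uniq pB).
have uq : uniq q by rewrite (perm_uniq qC).
have halves x y : x \in B -> y \in B -> x != y ->
    filter (pred2 x y) B = filter (pred2 x y) p /\ filter (pred2 x y) C = filter (pred2 x y) q.
  move=> xB yB xy.
  have xt : x != t by apply: contraNneq tB => <-.
  have yt : y != t by apply: contraNneq tB => <-.
  have [d dE] := filter_pair_uniq uB xB yB xy.
  have [|| e eE] := filter_pair_uniq uC _ _ xy; rewrite ?(perm_mem BC) //.
  have [|| d' dE'] := filter_pair_uniq up _ _ xy; rewrite ?(perm_mem pB) //.
  have [|| e' eE'] := filter_pair_uniq uq _ _ xy; rewrite ?(perm_mem qC) ?(perm_mem BC) //.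
  have [] : d = d' /\ e = e'; last by move=> de ee; rewrite dE eE dE' eE' de ee.
  apply: (@group_separates G).
  - move=> h; apply: hG1 => phi; have := h (phi letter_x) (phi letter_y) (phi letter_t).
    by rewrite !big_cons !big_nil !mulg1 !mulgA.
  - move=> h; apply: hG2 => phi; have := h (phi letter_x) (phi letter_y) (phi letter_t).
    by rewrite !big_cons !big_nil !mulg1 !mulgA.
  (* All letters other than [x], [y], [t] go to 1, so each half contributes only its restriction to
     [x] and [y]. *)
  move=> a b c; pose phi i :=
    if i == x then a else if i == y then b else if i == t then c else 1%g.
  have prodE s d0 : t \notin s ->
      filter (pred2 x y) s = (if d0 then [:: x; y] else [:: y; x]) ->
      (\prod_(i <- s) phi i = if d0 then a * b else b * a)%g.
    move=> ts sE; have -> : (\prod_(i <- s) phi i = \prod_(i <- filter (pred2 x y) s) phi i)%g.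
      rewrite big_filter [RHS]big_mkcond; apply: eq_big_seq => i si.
      rewrite /phi /=; case: (i == x) => //; case: (i == y) => //.
      by case: eqP si ts => // -> ->.
    by rewrite sE; case: d0 sE => _; rewrite !big_cons big_nil /phi !eqxx eq_sym (negbTE xy) mulg1.
  have := satG phi; rewrite !big_cat !big_cons /=.
  rewrite (prodE _ _ tB dE) (prodE _ _ tC eE) (prodE _ _ tp dE') (prodE _ _ tq eE').
  have -> : phi t = c by rewrite /phi eq_sym (negbTE xt) eq_sym (negbTE yt) eqxx.
  by rewrite !mulgA.
congr (_ ++ _ :: _).
  by apply/esym/eq_uniq_from_pairs => // x y xB yB xy; case: (halves x y).
apply/esym/eq_uniq_from_pairs => // x y; rewrite !(perm_mem BC) => xB yB xy.
by case: (halves x y).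
Qed.

End Isoterm.

(** * An antichain of simple permutations *)

(* In increasing order of key1 the letters read 1 z 3 2 5 4 7 6 ... m (m-1), and
   in increasing order of key2 they read 2 1 4 3 6 5 ... (m-1) (m-2) z m, where
   m = 2n+7 and z = 2n+8.  The pairs ordered differently by the two keys are
   {i, i+1} for 0 < i < m and {z, i} for 1 < i < m. *)
Definition key1 n i :=
  if i == n.*2 + 8 then 3 else if odd i then 2 * i else 2 * i + 3.
Definition key2 n i :=
  if i == n.*2 + 8 then 4 * n + 14 else if odd i then 2 * i + 3 else 2 * i.

(** The letter 0 is kept free to serve as the separator t in [zword]. *)
Definition zletter n : pred nat := fun i => 0 < i <= n.*2 + 8.

Ltac zigzag_lia := rewrite ?inE /zletter /key1 /key2; repeat case: ifP => ?; lia.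

Lemma key1_inj n : {in zletter n &, injective (key1 n)}.
Proof. move=> i j; zigzag_lia. Qed.

Lemma key2_inj n : {in zletter n &, injective (key2 n)}.
Proof. move=> i j; zigzag_lia. Qed.

Definition convex n (key : nat -> nat) (U : pred nat) := forall a b c,
  zletter n a -> zletter n b -> zletter n c -> U a -> U c -> key a < key b < key c -> U b.

(** Given i and i+1, the letter i+2 lies between them in one of the orders, and likewise i-1. So two
    consecutive letters spread along the whole path 1, ..., m, and z lies between 1 and 3 in
    [key1]. *)
Lemma zigzag_prime n (U : pred nat) a b :
  convex n (key1 n) U -> convex n (key2 n) U -> zletter n a -> zletter n b -> a != b ->
  U a -> U b -> forall c, zletter n c -> U c.
Proof.
move=> cv1 cv2.
have up i : 0 < i -> i.+2 < n.*2 + 8 -> U i -> U i.+1 -> U i.+2.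
  move=> i0 im Ui Ui1; case: (boolP (odd i)) => oi.
    by apply: (cv1 i i.+2 i.+1) => //; zigzag_lia.
  by apply: (cv2 i i.+2 i.+1) => //; zigzag_lia.
have down i : 0 < i -> i.+2 < n.*2 + 8 -> U i.+1 -> U i.+2 -> U i.
  move=> i0 im Ui1 Ui2; case: (boolP (odd i)) => oi.
    by apply: (cv2 i.+1 i i.+2) => //; zigzag_lia.
  by apply: (cv1 i.+1 i i.+2) => //; zigzag_lia.
have adj i : 0 < i -> i.+1 < n.*2 + 8 -> U i -> U i.+1 ->
    forall c, zletter n c -> U c.
  move=> i0 im Ui Ui1.
  have [U1 U2] : U 1 /\ U 2.
    elim: i i0 im Ui Ui1 => // -[|i] IH _ im Ui Ui1 //.
    by apply: IH => //; [lia | apply: down => //; lia].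
  have Upath j : 0 < j -> j.+1 < n.*2 + 8 -> U j /\ U j.+1.
    elim: j => // -[|j] IH _ jm //.
    have [//||Uj Uj1] := IH; first lia.
    by split=> //; apply: up.
  move=> c; case: (eqVneq c (n.*2 + 8)) => [->|cz] zc.
    have [//||_ U3] := Upath 2; first lia.
    by apply: (cv1 1 _ 3) => //; zigzag_lia.
  case: c cz zc => [|[|c]] cz zc //.
  by case: (Upath c.+1) => //; rewrite /zletter in zc; lia.
wlog: a b / a < b.
  move=> wl za zb ab Ua Ub; case: (ltngtP a b) => [|ba|/eqP]; last by rewrite (negbTE ab).
    by move=> lt; apply: (wl a b).
  by apply: (wl b a) => //; rewrite eq_sym.
move=> ab za zb _ Ua Ub.
(* Any two letters enclose, in one of the orders, enough letters to yield consecutive ones. For b =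
   z and a = 3 these are 5 and 6, which precede z in [key2] because m is at least 7. *)
have [c [c0 cm Uc Uc1]] : exists c, [/\ 0 < c, c.+1 < n.*2 + 8, U c & U c.+1].
  rewrite /zletter in za zb.
  have [bN|bN] := eqVneq b (n.*2 + 8).
    have [|a4] := leqP a 3; last first.
      by exists 2; split; [lia|lia| apply: (cv1 b 2 a)|apply: (cv1 b 3 a)] => //; zigzag_lia.
    case: a => [|[|[|[|a]]]] // in ab za Ua *.
    - by move=> _; exists 3; split;
      [lia|lia|apply: (cv2 1 3 b)|apply: (cv2 1 4 b)] => //; zigzag_lia.
    - by move=> _; exists 1; split; [lia|lia| apply: (cv2 2 1 b)|] => //; zigzag_lia.
    - by move=> _; exists 5; split;
      [lia|lia|apply: (cv2 3 5 b)|apply: (cv2 3 6 b)] => //; zigzag_lia.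
  have [b1|b1] := eqVneq b a.+1; first by exists a; split; rewrite -?b1 //; lia.
  have [b2|b2] := eqVneq b a.+2; case: (boolP (odd a)) => oa.
  - have [ge|lt] := leqP (n.*2 + 8) a.+3.
      exists a.-1; rewrite prednK; last lia.
      by split; [lia|lia|apply: (cv1 a _ b)|] => //; zigzag_lia.
    by exists b; split; [lia|lia| |apply: (cv2 a _ b)] => //; zigzag_lia.
  - by exists b; split; [lia|lia| |apply: (cv1 a _ b)] => //; zigzag_lia.
  - by exists a; split; [lia|lia| |apply: (cv1 a _ b)] => //; zigzag_lia.
  - by exists a; split; [lia|lia| |apply: (cv2 a _ b)] => //; zigzag_lia.
exact: adj Uc Uc1.
Qed.

(* The letter z is the only one that precedes three others in key1 and follows
   them in key2, so emb preserves z; then it preserves 1, the only letter before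
   z in key1, and m, the only letter after z in key2.  Finally the pairs
   {i, i+1} form a path along which emb moves one step at a time. *)
Lemma zigzag_rigid k n (emb : nat -> nat) :
  (forall a, zletter k a -> zletter n (emb a)) ->
  (forall a b, zletter k a -> zletter k b ->
    key1 k a < key1 k b -> key1 n (emb a) < key1 n (emb b)) ->
  (forall a b, zletter k a -> zletter k b ->
    key2 k a < key2 k b -> key2 n (emb a) < key2 n (emb b)) ->
  k = n.
Proof.
move=> ran mono1 mono2.
have inj a b : zletter k a -> zletter k b -> emb a = emb b -> a = b.
  move=> za zb iab; apply: (key1_inj za zb); apply/eqP; case: ltngtP => //.
    by move=> /(mono1 _ _ za zb); rewrite iab ltnn.
  by move=> /(mono1 _ _ zb za); rewrite iab ltnn.
pose z := k.*2 + 8; have zz : zletter k z by rewrite /zletter /z; lia.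
have zx i : i <= 7 -> 0 < i -> zletter k i by rewrite /zletter; lia.
have inverted_path i j : zletter n i -> zletter n j -> i <> n.*2 + 8 ->
    key1 n i < key1 n j -> key2 n j < key2 n i ->
    j <> n.*2 + 8 /\ (j = i.+1 \/ i = j.+1).
  move=> zi zj; zigzag_lia.
have iz : emb z = n.*2 + 8.
  (* Otherwise the distinct images of 2, 3 and 4 would all be neighbours of [emb z] on a path, where
     a letter has at most two. *)
  apply/eqP/negPn/negP => /eqP iz.
  have near i : 1 < i -> i < 6 -> emb i = (emb z).+1 \/ emb z = (emb i).+1.
    move=> i1 i6; have zi : zletter k i by rewrite /zletter; lia.
    have [||_] := inverted_path _ _ (ran _ zz) (ran _ zi) iz => //.
      by apply: mono1 => //; rewrite /z; zigzag_lia.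
    by apply: mono2 => //; rewrite /z; zigzag_lia.
  have [n2 n3 n4] := And3 (near 2 isT isT) (near 3 isT isT) (near 4 isT isT).
  have d23 := inj 2 3 (zx 2 isT isT) (zx 3 isT isT).
  have d24 := inj 2 4 (zx 2 isT isT) (zx 4 isT isT).
  have d34 := inj 3 4 (zx 3 isT isT) (zx 4 isT isT).
  lia.
have i1 : emb 1 = 1.
  have : key1 n (emb 1) < key1 n (emb z).
    by apply: mono1 => //; rewrite ?zx // /z; zigzag_lia.
  have := ran _ (zx 1 isT isT); rewrite iz; zigzag_lia.
have im : emb (k.*2 + 7) = n.*2 + 7.
  have zm : zletter k (k.*2 + 7) by rewrite /zletter; lia.
  have : key2 n (emb z) < key2 n (emb (k.*2 + 7)).
    by apply: mono2 => //; rewrite /z; zigzag_lia.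
  have := ran _ zm; rewrite iz; zigzag_lia.
have path i : 0 < i -> i.+1 < k.*2 + 8 ->
    emb i.+1 = (emb i).+1 \/ emb i = (emb i.+1).+1.
  move=> i0 ik.
  have zi : zletter k i by rewrite /zletter; lia.
  have zi1 : zletter k i.+1 by rewrite /zletter; lia.
  have nz j : zletter k j -> j <> z -> emb j <> n.*2 + 8.
    by move=> zj jz; rewrite -iz => /(inj _ _ zj zz).
  case: (boolP (odd i)) => oi.
    have [|||_] := inverted_path _ _ (ran _ zi) (ran _ zi1); last by [].
    - by apply: nz => //; rewrite /z; lia.
    - by apply: mono1 => //; zigzag_lia.
    - by apply: mono2 => //; zigzag_lia.
  have [|||_] := inverted_path _ _ (ran _ zi1) (ran _ zi); last by case; auto.
  - by apply: nz => //; rewrite /z; lia.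
  - by apply: mono1 => //; zigzag_lia.
  - by apply: mono2 => //; zigzag_lia.
have idpath i : 0 < i -> i.+1 < k.*2 + 8 -> emb i = i /\ emb i.+1 = i.+1.
  elim: i => // -[|i] IH _ ik.
    split=> //; have := path 1 isT ik; rewrite i1.
    have := ran 2 (zx 2 isT isT); rewrite /zletter; lia.
  have [//||e1 e2] := IH; first lia.
  split=> //; have := path i.+2 isT ik; rewrite e2 => -[//|[e3]].
  have : i.+3 = i.+1 by apply: inj; rewrite ?e1 -?e3 // /zletter; lia.
  lia.
(* The last letter 2k+7 of the path is fixed by [idpath] and sent to 2n+7 by [im]. *)
have [||_] := idpath (k.*2 + 6); [lia|lia|].
by rewrite -addnS im; lia.
Qed.

(** * The two words of a permutation and their common intervals *)

Definition zletters n : word := iota 1 (n.*2 + 8).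
Definition word1 n : word := sort (relpre (key1 n) leq) (zletters n).
Definition word2 n : word := sort (relpre (key2 n) leq) (zletters n).

Lemma mem_zletters n : zletters n =i zletter n.
Proof. by move=> i; rewrite mem_iota unfold_in /zletter; lia. Qed.

Lemma mem_word1 n : word1 n =i zletter n.
Proof. by move=> i; rewrite mem_sort mem_zletters. Qed.

Lemma mem_word2 n : word2 n =i zletter n.
Proof. by move=> i; rewrite mem_sort mem_zletters. Qed.

Lemma perm_word12 n : perm_eq (word2 n) (word1 n).
Proof. by rewrite perm_sort perm_sym perm_sort. Qed.

Lemma word1_uniq n : uniq (word1 n).
Proof. by rewrite sort_uniq iota_uniq. Qed.

Lemma word2_uniq n : uniq (word2 n).
Proof. by rewrite sort_uniq iota_uniq. Qed.

Lemma notin_word1 n : 0 \notin word1 n.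
Proof. by rewrite mem_word1. Qed.

Lemma notin_word2 n : 0 \notin word2 n.
Proof. by rewrite mem_word2. Qed.

Lemma pairwise_sort_key (key : nat -> nat) (s : word) :
  uniq s -> {in s &, injective key} ->
  pairwise (relpre key ltn) (sort (relpre key leq) s).
Proof.
move=> us inj; rewrite -pairwise_map -sort_map -sorted_pairwise; last exact: ltn_trans.
rewrite ltn_sorted_uniq_leq sort_uniq map_inj_in_uniq // us /=.
by apply: sort_sorted; apply: leq_total.
Qed.

Lemma word1_pairwise n : pairwise (relpre (key1 n) ltn) (word1 n).
Proof.
apply: pairwise_sort_key; rewrite ?iota_uniq // => i j.
by rewrite !mem_zletters; apply: key1_inj.
Qed.

Lemma word2_pairwise n : pairwise (relpre (key2 n) ltn) (word2 n).
Proof.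
apply: pairwise_sort_key; rewrite ?iota_uniq // => i j.
by rewrite !mem_zletters; apply: key2_inj.
Qed.

(** A letter before the factor has a smaller key than [a], and one after it a larger key than
    [c]. *)
Lemma infix_between (key : nat -> nat) (s L : word) a b c :
  pairwise (relpre key ltn) L -> infix s L -> a \in s -> c \in s -> b \in L ->
  key a < key b < key c -> b \in s.
Proof.
move=> pL /infixP[p [q LE]] sa cs; subst L.
rewrite !mem_cat => /or3P[bp|//|bq] /andP[ab bc].
- move: pL; rewrite pairwise_cat => /and3P[/allrelP/(_ b a bp)].
  by rewrite mem_cat sa => /(_ isT) /= /ltn_trans/(_ ab); rewrite ltnn.
- move: pL; rewrite catA pairwise_cat => /and3P[/allrelP/(_ c b)].
  by rewrite mem_cat cs orbT => /(_ isT bq) /= /ltn_trans/(_ bc); rewrite ltnn.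
Qed.

Lemma infix_all (s L : word) : uniq L -> infix s L -> {subset L <= s} -> s = L.
Proof.
move=> uL /infixP[p [q LE]] Ls; have := uniq_leq_size uL Ls.
rewrite LE !size_cat => le; have [] : size p = 0 /\ size q = 0 by lia.
by move=> /size0nil-> /size0nil->; rewrite cats0.
Qed.

Lemma common_interval n u v :
  infix u (word1 n) -> infix v (word2 n) -> perm_eq u v ->
  size u <= 1 \/ u = word1 n /\ v = word2 n.
Proof.
move=> iu iv uv; case: (leqP (size u) 1) => [|su]; [by left|right].
have uu : uniq u by apply: infix_uniq iu (word1_uniq n).
have [a [b [au bu ab]]] : exists a b, [/\ a \in u, b \in u & a != b].
  case: u su uu {iu uv} => [|a [|b u]] //= _ /andP[]; rewrite inE negb_or => /andP[ab _ _].
  by exists a, b; rewrite !inE !eqxx orbT.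
have full : forall c, zletter n c -> c \in u.
  apply: (@zigzag_prime n (fun c => c \in u) a b) => //.
  - move=> x y z _ yl _ xu zu; apply: (infix_between (word1_pairwise n) iu xu zu).
    by rewrite mem_word1.
  - move=> x y z _ yl _; rewrite !(perm_mem uv) => xv zv.
    apply: (infix_between (word2_pairwise n) iv xv zv).
    by rewrite mem_word2.
  - by have := mem_infix iu au; rewrite mem_word1.
  - by have := mem_infix iu bu; rewrite mem_word1.
split; apply: infix_all; rewrite ?word1_uniq ?word2_uniq // => c.
  by rewrite mem_word1; apply: full.
by rewrite mem_word2 -(perm_mem uv); apply: full.
Qed.

(** The letters 1 and 2 come in opposite orders. *)
Lemma word12_neq n : word1 n <> word2 n.
Proof.
move=> E; have := word1_pairwise n; have := word2_pairwise n; rewrite -E.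
have m1 : 1 \in word1 n by rewrite mem_word1 unfold_in /zletter; lia.
have m2 : 2 \in word1 n by rewrite mem_word1 unfold_in /zletter; lia.
case/splitPr: (word1 n) / m1 m2 => p q.
rewrite !mem_cat !inE /= => m2; rewrite !pairwise_cat /=.
move=> /and3P[/allrelP p2 _ /andP[/allP q2 _]] /and3P[/allrelP p1 _ /andP[/allP q1 _]].
case/orP: m2 => [m2|m2].
  by have := p1 2 1 m2 (mem_head _ _); rewrite /= /key1; do ?case: ifP; lia.
by have := q2 2 m2; rewrite /= /key2; do ?case: ifP; lia.
Qed.

Lemma common_factor n u : infix u (word1 n) -> infix u (word2 n) -> size u <= 1.
Proof.
move=> i1 i2; case: (common_interval i1 i2) => // -[E1 E2].
by case: (@word12_neq n); rewrite -E1 -E2.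
Qed.

(** * Substitutions and independence of the identities *)

Lemma perm_subst phi u v : perm_eq u v -> perm_eq (subst phi u) (subst phi v).
Proof. by move=> uv; apply: perm_flatten; apply: perm_map. Qed.

Lemma infix_subst phi u i : i \in u -> infix (phi i) (subst phi u).
Proof.
case/splitPr=> p q; apply/infixP; exists (subst phi p), (subst phi q).
by rewrite subst_cat.
Qed.

Lemma subst_mono (key key' : nat -> nat) phi s x y a b :
  pairwise (relpre key ltn) s -> pairwise (relpre key' ltn) (subst phi s) ->
  x \in s -> y \in s -> key x < key y -> a \in phi x -> b \in phi y ->
  key' a < key' b.
Proof.
move=> ps pphi xs ys xy ax yb; case/splitPr: s / ys ps pphi xs => p q.
rewrite subst_cat !pairwise_cat => /and3P[_ _ /= /andP[/allP pq _]].
move=> /and3P[/allrelP pphi _ _]; rewrite mem_cat inE => /or3P[xp|/eqP xy'|xq].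
- apply: (pphi a b).
    by apply: mem_infix ax; apply: infix_subst.
  by rewrite /subst /= mem_cat yb.
- by rewrite xy' ltnn in xy.
- by have := pq _ xq; rewrite /= ltnNge ltnW.
Qed.

(** Each [phi x] is a factor of both words of index [k], hence has at most one letter. Sending a
    letter to the one whose image contains it therefore preserves both orders strictly, and
    [zigzag_rigid] applies. *)
Lemma subst_words k n phi :
  subst phi (word1 n) = word1 k -> subst phi (word2 n) = word2 k -> k = n.
Proof.
move=> E1 E2.
have small x : x \in word1 n -> size (phi x) <= 1.
  move=> xn; apply: (@common_factor k); rewrite -?E1 -?E2; apply: infix_subst => //.
  by rewrite (perm_mem (perm_word12 n)).
pose emb a := nth 0 (word1 n) (find (fun x => a \in phi x) (word1 n)).
have embP a : zletter k a -> emb a \in word1 n /\ a \in phi (emb a).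
  rewrite -[zletter k a]/(a \in zletter k) -mem_word1 -E1 => /flatten_mapP[x xn ax].
  have hs : has (fun x => a \in phi x) (word1 n) by apply/hasP; exists x.
  by split; [rewrite mem_nth -?has_find|exact: (nth_find 0 hs)].
have emb2 a : zletter k a -> emb a \in word2 n.
  by move=> /embP[]; rewrite (perm_mem (perm_word12 n)).
have phi_inj x a b : x \in word1 n -> a \in phi x -> b \in phi x -> a = b.
  move=> /small; case: (phi x) => [|c [|d s]] // _.
  by rewrite !inE => /eqP-> /eqP->.
apply: (@zigzag_rigid k n emb).
- by move=> a /embP[]; rewrite mem_word1.
- move=> a b za zb ab; have [ia aa] := embP a za; have [ib bb] := embP b zb.
  case: (ltngtP (key1 n (emb a)) (key1 n (emb b))) => //.
    move=> lt; have := subst_mono (word1_pairwise n) (key' := key1 k) (phi := phi)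
      _ ib ia lt bb aa.
    by rewrite E1 => /(_ (word1_pairwise k)); rewrite ltnNge ltnW.
  move=> E; move: (aa); rewrite (key1_inj _ _ E) -?mem_word1 // => aa'.
  by rewrite (phi_inj _ _ _ ib aa' bb) ltnn in ab.
- move=> a b za zb ab; have [ia aa] := embP a za; have [ib bb] := embP b zb.
  case: (ltngtP (key2 n (emb a)) (key2 n (emb b))) => //.
    move=> lt; have := subst_mono (word2_pairwise n) (key' := key2 k) (phi := phi)
      _ (emb2 _ zb) (emb2 _ za) lt bb aa.
    by rewrite E2 => /(_ (word2_pairwise k)); rewrite ltnNge ltnW.
  move=> E; move: (aa); rewrite (key2_inj _ _ E) -?mem_word1 // => aa'.
  by rewrite (phi_inj _ _ _ ib aa' bb) ltnn in ab.
Qed.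

Definition zword n : word := word1 n ++ 0 :: word2 n.
Definition zword_sorted n : word := word1 n ++ 0 :: word1 n.

(** A nonempty [u] shares a letter with [v], so [u ++ s ++ v] fits into neither [B] nor [C]. As [t]
    occurs only once, it is in neither [u] nor [v], and must fall inside [s]. *)
Lemma infix_split (t : nat) (B C u s v : word) :
  uniq B -> uniq C -> t \notin B -> t \notin C -> perm_eq u v ->
  infix (u ++ s ++ v) (B ++ t :: C) -> u = [::] \/ infix u B /\ infix v C.
Proof.
move=> uB uC tB tC uv /infixP[p [q E]].
have [->|u0] := eqVneq u [::]; [by left|right].
have [a au] : exists a, a \in u by case: u u0 {uv E} => // a u; exists a; rewrite mem_head.
have av : a \in v by rewrite -(perm_mem uv).
have notuniq L p' q' : uniq L -> L = p' ++ (u ++ s ++ v) ++ q' -> False.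
  move=> uL LE; move: uL; rewrite LE !cat_uniq => /and3P[_ _ /andP[/and3P[_ /hasP[]]]].
  by exists a; rewrite // mem_cat av orbT.
have piv p' q' : p ++ (u ++ s ++ v) ++ q = p' ++ t :: q' -> B = p' /\ C = q'.
  by rewrite -E => /eqP; rewrite eqseq_pivotl // => /andP[/eqP-> /eqP->].
have count_t : count_mem t (p ++ (u ++ s ++ v) ++ q) = 1.
  by rewrite -E count_cat /= eqxx !(count_memPn _).
have tn : t \notin u.
  apply/negP => tu; have tv : t \in v by rewrite -(perm_mem uv).
  move: count_t tu tv; rewrite -!has_pred1 !has_count !count_cat; lia.
have tnv : t \notin v by rewrite -(perm_mem uv).
have : t \in p ++ (u ++ s ++ v) ++ q by rewrite -E mem_cat mem_head orbT.
rewrite !mem_cat (negbTE tn) (negbTE tnv) /= orbF => /or3P[/splitPr|/splitPr|/splitPr] tin.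
- case: tin piv {count_t E} => p1 p2 /(_ p1 (p2 ++ (u ++ s ++ v) ++ q)).
  by rewrite -catA => /(_ erefl)[_ CE]; case: (notuniq C p2 q uC).
- case: tin piv {count_t E notuniq} => s1 s2 /(_ (p ++ u ++ s1) (s2 ++ v ++ q)).
  rewrite -!catA => /(_ erefl)[-> ->].
  by split; apply/infixP; [exists p, s1|exists s2, q].
- case: tin piv {count_t E} => q1 q2 /(_ (p ++ (u ++ s ++ v) ++ q1) q2).
  by rewrite -!catA => /(_ erefl)[BE _]; case: (notuniq B p q1 uB); rewrite BE -!catA.
Qed.

Lemma zword_independent k n :
  satisfies (Smon (zword k)) (zword n) (zword_sorted n) <-> k != n.
Proof.
split=> [/satisfies_Smon/(_ (fun i => [:: i]))|kn].
  (* For k = n the identity substitution already refutes the identity. *)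
  have substE u : subst (fun i => [:: i]) u = u by apply: flatten_seq1.
  rewrite !substE; apply: contraL => /eqP->.
  rewrite /rees_rel infix_refl orbF /zword /zword_sorted eqseq_cat // eqxx /=.
  rewrite eqseq_cons eqxx /=.
  by apply/eqP/nesym/word12_neq.
apply/satisfies_Smon => phi.
pose u := subst phi (word1 n); pose v := subst phi (word2 n).
have uv : perm_eq u v by apply: perm_subst; rewrite perm_sym perm_word12.
have -> : subst phi (zword n) = u ++ phi 0 ++ v by rewrite /zword subst_cat.
have -> : subst phi (zword_sorted n) = u ++ phi 0 ++ u by rewrite /zword_sorted subst_cat.
have split x : perm_eq u x -> infix (u ++ phi 0 ++ x) (zword k) ->
    u = [::] \/ infix u (word1 k) /\ infix x (word2 k).
  by apply: infix_split; rewrite ?word1_uniq ?word2_uniq ?notin_word1 ?notin_word2.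
(* Once either side becomes a factor of [zword k], the two images agree; otherwise both sides fall
   into the collapsed ideal. *)
have eq_of_infix :
    infix (u ++ phi 0 ++ v) (zword k) || infix (u ++ phi 0 ++ u) (zword k) -> u = v.
  case/orP => /split[] //.
  - by move=> u0; apply/esym/perm_small_eq; rewrite ?u0 // perm_sym -u0.
  - move=> [iu iv]; case: (common_interval iu iv uv) => [su|[E1 E2]].
      by apply/esym; apply: perm_small_eq => //; rewrite perm_sym.
    by case/eqP: kn; apply: subst_words E1 E2.
  - by move=> u0; apply/esym/perm_small_eq; rewrite ?u0 // perm_sym -u0.
  - by move=> [i1 i2]; apply/esym/perm_small_eq; rewrite ?(common_factor i1 i2) // perm_sym.
rewrite /rees_rel; case: (boolP (infix (u ++ phi 0 ++ v) _)) eq_of_infix => [_ /(_ isT)->|_] /=.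
  by rewrite eqxx.
by case: (boolP (infix (u ++ phi 0 ++ u) _)) => [_ /(_ isT)->|_ _]; rewrite ?eqxx ?orbT.
Qed.

Theorem corollary3p1 (G : finGroupType)
  (hG1 : ~ satisfies G
     [:: letter_x; letter_y; letter_t; letter_x; letter_y]
     [:: letter_y; letter_x; letter_t; letter_y; letter_x])
  (hG2 : ~ satisfies G
     [:: letter_x; letter_y; letter_t; letter_y; letter_x]
     [:: letter_y; letter_x; letter_t; letter_x; letter_y]) :
  continuum_many (subvariety (generated_variety
    (Smon [:: letter_x; letter_t; letter_x] * G)%type)).
Proof.
apply: (@continuum_many_subvarieties _ zword zword_sorted (fun n => Smon (zword n))).
- exact: generated_variety_is_variety.
- move=> n; apply: isoterm_Smon; apply: split_isoterm => //.
  + exact: word1_uniq.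
  + exact: perm_word12.
  + exact: notin_word1.
- exact: zword_independent.
Qed.
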